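(* Let $f:\mathbb{R}^{d_\theta}\to\mathbb{R}$ be differentiable with locally Lipschitz continuous gradient, let $\{\alpha_n\}_{n\ge0}$ be positive real numbers, and let $\{\theta_n\}_{n\ge 0}$ be $\mathbb{R}^{d_\theta}$-valued random variables on a probability space $(\Omega,\mathcal F,P)$ satisfying $$\theta_{n+1}=\theta_n-\alpha_n(\nabla f(\theta_n)+\xi_n),\qquad n\ge0,$$ where $\{\xi_n\}_{n\ge0}$ is an $\mathbb{R}^{d_\theta}$-valued stochastic process on the same space. Suppose: (1) $\lim_{n\to\infty}\alpha_n=0$ and $\sum_{n=0}^\infty\alpha_n=\infty$. (2) There is a real number $r\in(1,\infty)$ such that, w.p.1 on $\{\sup_{n\ge0}\|\theta_n\|<\infty\}$, for all $t\in(0,\infty)$, $$\limsup_{n\to\infty}\ \max_{n\le k<a(n,t)}\Big\|\sum_{i=n}^k\alpha_i\gamma_i^r\xi_i\Big\|<\infty .$$ (3) For any compact set $Q\subset\mathbb{R}^{d_\theta}$ and any $a\in f(Q)$ there exist real numbers $\delta_{Q,a}\in(0,1]$, $\mu_{Q,a}\in(1,2]$, $M_{Q,a}\in[1,\infty)$ such that $|f(\theta)-a|\le M_{Q,a}\|\nabla f(\theta)\|^{\mu_{Q,a}}$ for all $\theta\in Q$ satisfying $|f(\theta)-a|\le\delta_{Q,a}$. Then $\hat\theta=\lim_{n\to\infty}\theta_n$ exists and satisfies $\nabla f(\hat\theta)=0$ w.p.1 on $\{\sup_{n\ge0}\|\theta_n\|<\infty\}$.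
   Context: $\|\cdot\|$ is the Euclidean norm. $\gamma_0=0$ and $\gamma_n=\sum_{i=0}^{n-1}\alpha_i$ for $n\ge1$. For $t\in(0,\infty)$ and $n\ge0$, $a(n,t)=\max\{k\ge n:\gamma_k-\gamma_n\le t\}$. No independence or adaptedness is imposed on $\xi_n$ (it may be a random function of $\theta_0,\dots,\theta_n$). ''W.p.1 on an event $\Lambda$'' means for all $\omega\in\Lambda$ outside a set of probability zero. *)

(* Defs.v *)
From HB Require Import structures.
From mathcomp Require Export all_boot all_order all_algebra.
From mathcomp Require Export all_classical all_reals all_analysis.
Export Order.TTheory GRing.Theory Num.Theory.
Export numFieldNormedType.Exports.

Set Implicit Arguments.
Unset Strict Implicit.
Unset Printing Implicit Defensive.

Local Open Scope classical_set_scope.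
Local Open Scope ring_scope.

(* R^d is 'rV[R]_d. The library norm `|x| of a row vector is the sup norm, so
   the Euclidean norm is defined here; both induce the same topology. *)
Definition enorm (R : realType) (d : nat) (x : 'rV[R]_d) : R :=
  Num.sqrt (\sum_(i < d) x 0 i ^+ 2).

Definition gradient (R : realType) (d : nat) (f : 'rV[R]_d -> R)
    (x : 'rV[R]_d) : 'rV[R]_d :=
  \row_(i < d) 'D_(delta_mx 0 i) f x.

(* The Lipschitz constants are relative to the sup norm, which is equivalent to
   the Euclidean one. *)
Definition locally_lipschitz (R : realType) (d : nat)
    (g : 'rV[R]_d -> 'rV[R]_d) : Prop :=
  forall x : 'rV[R]_d,
    exists2 U : set 'rV[R]_d, nbhs x U & [lipschitz (g y) | y in U].

Definition random_vector (disp : measure_display) (T : measurableType disp)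
    (R : realType) (d : nat) (X : T -> 'rV[R]_d) : Prop :=
  measurable_fun [set: T]
    (X : T -> g_sigma_algebraType (@open 'rV[R]_d)).

Definition gamma (R : realType) (alpha : nat -> R) (n : nat) : R :=
  \sum_(0 <= i < n) alpha i.

(* The maximum of {k >= n : gamma_k - gamma_n <= t}. It exists for t >= 0 when
   alpha > 0 and gamma diverges (see horizonP); otherwise the value may be the
   default n. *)
Definition horizon (R : realType) (alpha : nat -> R) (n : nat) (t : R) : nat :=
  let S := [set k | (n <= k)%N /\ gamma alpha k - gamma alpha n <= t] in
  xget n [set k | S k /\ forall j, S j -> (j <= k)%N].

Lemma horizonP (R : realType) (alpha : nat -> R) (n : nat) (t : R) :
    (forall i, 0 < alpha i) -> gamma alpha n @[n --> \oo] --> +oo -> 0 <= t ->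
  [/\ (n <= horizon alpha n t)%N,
      gamma alpha (horizon alpha n t) - gamma alpha n <= t &
      forall j, (n <= j)%N -> gamma alpha j - gamma alpha n <= t ->
        (j <= horizon alpha n t)%N].
Proof.
move=> alpha0 goo t0.
have gmon i j : (i <= j)%N -> gamma alpha i <= gamma alpha j.
  move=> ij; rewrite /gamma (big_cat_nat _ ij)//= lerDl.
  by apply: sumr_ge0 => k _; exact: ltW.
have /cvgryPgt /(_ (gamma alpha n + t)) [N _ HN] := goo.
pose p k := (n <= k)%N && (gamma alpha k - gamma alpha n <= t).
have pn : exists k, p k by exists n; rewrite /p leqnn subrr.
have pN k : p k -> (k <= N)%N.
  case/andP=> _ pk; rewrite leqNgt; apply/negP => /ltnW Nk.
  by have := HN k Nk; rewrite /= ltNge addrC -lerBlDr pk.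
rewrite /horizon; case: xgetP => [k _ [[nk kt] kmax]|none].
  by split=> // j nj jt; apply: kmax.
case: (ex_maxnP pn pN) => m /andP[nm mt] mmax.
exfalso; apply: (none m); split=> // j [nj jt].
by apply: mmax; rewrite /p nj.
Qed.

(* max_{n <= k < a(n,t)} || sum_{i=n}^k alpha_i gamma_i^r x_i ||, with the
   maximum over the empty range equal to 0. *)
Definition max_weighted_sum (R : realType) (d : nat) (alpha : nat -> R) (r : R)
    (x : nat -> 'rV[R]_d) (t : R) (n : nat) : R :=
  \big[Order.max/0]_(n <= k < horizon alpha n t)
    enorm (\sum_(n <= i < k.+1) (alpha i * gamma alpha i `^ r) *: x i).

Definition bounded_seq (R : realType) (d : nat) (x : nat -> 'rV[R]_d) : Prop :=
  (ereal_sup (range (fun n => (enorm (x n))%:E)) < +oo)%E.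

(* Main.v *)
From HB Require Import structures.
Require Import Defs.
From mathcomp Require Import ring lra.

(** The argument is pathwise: it fixes a sample point at which the iterates are
bounded and the noise condition holds.  Let [rho] bound the iterates, [L] be a
Lipschitz constant of the gradient on the ball of radius [rho], and cut time,
measured by [gamma], into blocks [n_j <= n < n_(j+1)] of length between [T / 2]
and [T], with [T] of order [1 / (d L)].

Summation by parts against the weights [gamma ^ r] turns the noise condition
into a bound [eps_j], of order [j ^ (-r)], on the noise accumulated within block
[j] ([noise_sum_le]).  Because [r > 1] these bounds are summable, and because
[T L] is small the iterates move within a block by at most
[2 (T |grad f(x_j)| + eps_j)], where [x_j] is the iterate that starts the block
([block_drift]).  A whole block is thus one step of gradient descent with a small
relative error and an additional error [eps_j], so that
[f(x_(j+1)) <= f(x_j) - (T / 4) |grad f(x_j)|^2 + C eps_j^2]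
([block_descent]).

Adding to [f(x_j)] a bound [tau_j], of order [j ^ (1 - 2 r)], on the future
errors [eps_i^2] gives a nonincreasing sequence.  Hence [f(x_j)] converges to
some [l] and [grad f(x_j)] tends to 0.  Set [v_j = f(x_j) - l + tau_j].  The
Lojasiewicz inequality with exponent [mu] bounds [v_j ^ (1 / mu)] by a multiple of
[|grad f(x_j)| + j ^ (- (2 r - 1) / mu)], and concavity of
[v |-> v ^ (1 - 1 / mu)] then bounds the sum of the [|grad f(x_j)|], provided that
[(2 r - 1) / mu > 1] ([kl_sum_le], [perturbed_descent_summable]).  That proviso costs nothing: where the gradient
is at most 1 the inequality with exponent [mu] implies the one with exponent
[min(mu, r)], and [r < 2 r - 1].  So the displacements [|x_(j+1) - x_j|] are
summable, the [x_j] converge, the iterates inside the blocks converge to the same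
point, and by continuity the gradient vanishes there.

All estimates use the sup norm of row vectors; the Euclidean norm enters only
through [normr_le_enorm] and [enorm_le_normr]. *)

Local Open Scope classical_set_scope.
Local Open Scope ring_scope.

Set Implicit Arguments.
Unset Strict Implicit.
Unset Printing Implicit Defensive.

(** * Real powers and power sums *)

Lemma powR_amgm (R : realType) (p x y : R) : 0 < p < 1 -> 0 <= x -> 0 <= y ->
  x `^ p * y `^ (1 - p) <= p * x + (1 - p) * y.
Proof.
move=> /andP[p0 p1] x0 y0; have q0 : 0 < 1 - p by rewrite subr_gt0.
have := @conjugate_powR R (x `^ p) (y `^ (1 - p)) p^-1 (1 - p)^-1
  (powR_ge0 _ _) (powR_ge0 _ _).
rewrite !invr_gt0 p0 q0 !invrK => /(_ isT isT (subrKC _ _)).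
by rewrite -!powRrM !mulfV ?gt_eqF// !powRr1// [x * p]mulrC [y * _]mulrC.
Qed.

(** The tangent inequality for the concave map [t |-> t `^ (1 - p)] at [x],
multiplied by [x `^ p] so that it holds at [x = 0] as well. *)
Lemma powR_concave_diff (R : realType) (p x y : R) :
    0 < p < 1 -> 0 <= x -> 0 <= y ->
  (1 - p) * (x - y) <= x `^ p * (x `^ (1 - p) - y `^ (1 - p)).
Proof.
move=> p01 x0 y0; have amgm := powR_amgm p01 x0 y0.
have xE : x `^ p * x `^ (1 - p) = x.
  by rewrite -powRD ?subrKC ?powRr1// oner_eq0.
by rewrite [leRHS]mulrBr xE; lra.
Qed.

(** A convex function lies above its tangent: the convexity of
[t |-> t `^ (- s)] at [x], obtained from [1 + z <= expR z] and
[ln (1 + z) <= z]. *)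
Lemma powRN_tangent (R : realType) (s x y : R) : 0 <= s -> 0 < x -> 0 < y ->
  x `^ (- s) * (1 + s * (1 - y / x)) <= y `^ (- s).
Proof.
move=> s0 x0 y0; have yx0 : 0 < y / x by rewrite divr_gt0.
have -> : y `^ (- s) = x `^ (- s) * (y / x) `^ (- s).
  by rewrite -powRM ?ltW// mulrC divfK// gt_eqF.
rewrite ler_wpM2l ?powR_ge0// /powR gt_eqF//.
apply: le_trans (expR_ge1Dx _); rewrite lerD2l mulNr -mulrN ler_wpM2l//.
have := @le_ln1Dx R (y / x - 1).
by rewrite subrKC => /(_ _); lra.
Qed.

(** Replaces the comparison of a power sum with an integral, both for the
convergence of the sum ([sum_powRN_le]) and for the explicit majorant
[tail_bound] of its tails. *)
Lemma powRN_telescope (R : realType) (q : R) (j : nat) : 1 < q ->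
  (q - 1) * j.+2%:R `^ (- q) <= j.+1%:R `^ (1 - q) - j.+2%:R `^ (1 - q).
Proof.
move=> q1; have q10 : 0 <= q - 1 by rewrite subr_ge0 ltW.
have := @powRN_tangent R (q - 1) j.+2%:R j.+1%:R q10 (ltr0Sn _ _) (ltr0Sn _ _).
rewrite opprB; set A := _.+2%:R `^ (1 - q).
have AE : A = j.+2%:R * j.+2%:R `^ (- q).
  by rewrite /A powRD ?powRr1//; apply/implyP; rewrite pnatr_eq0.
have -> : 1 - j.+1%:R / j.+2%:R = j.+2%:R^-1 :> R.
  have : j.+1%:R + 1 != 0 :> R by rewrite natr1 pnatr_eq0.
  by rewrite -[j.+2%:R]natr1; move: (j.+1%:R : R) => a a0; field.
rewrite mulrDr mulr1 => AB.
suff <- : A * ((q - 1) / j.+2%:R) = (q - 1) * j.+2%:R `^ (- q).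
  by rewrite lerBrDl.
by rewrite AE mulrC mulrA divfK// pnatr_eq0.
Qed.

Lemma sum_powRN_le (R : realType) (q : R) (n : nat) : 1 < q ->
  \sum_(0 <= j < n) j.+2%:R `^ (- q) <= (q - 1)^-1.
Proof.
move=> q1; have q10 : 0 < q - 1 by rewrite subr_gt0.
rewrite -[leRHS]mul1r ler_pdivlMr// mulrC mulr_sumr.
apply: (@le_trans _ _ (\sum_(0 <= j < n)
    (j.+1%:R `^ (1 - q) - j.+2%:R `^ (1 - q)))).
  by apply: ler_sum => j _; exact: powRN_telescope.
rewrite (telescope_sumr_eq (fun j => - j.+1%:R `^ (1 - q)))//.
  by rewrite powR1 opprK addrC gerBl powR_ge0.
by move=> j _; rewrite opprK addrC.
Qed.

Lemma powRN_natS_cvg0 (R : realType) (q : R) : 0 < q ->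
  (j.+1%:R : R) `^ (- q) @[j --> \oo] --> 0.
Proof.
move=> q0; apply/cvgr0Pnorm_lt => e e0; near=> j; rewrite ger0_norm ?powR_ge0//.
rewrite powRN invf_plt ?posrE ?powR_gt0//.
have eE : e^-1 = (e^-1 `^ q^-1) `^ q.
  by rewrite -powRrM mulVf ?gt_eqF// powRr1// invr_ge0 ltW.
rewrite eE gt0_ltr_powR ?nnegrE ?powR_ge0//.
rewrite -natr1 ltr_pwDr//; near: j; exact: nbhs_infty_ger.
Unshelve. all: by end_near. Qed.

(** * Perturbed descent under a Lojasiewicz inequality *)

(** The finite-length argument behind the Lojasiewicz inequality: the energy
loss [c * g j ^+ 2], measured in the scale [v `^ (1 - p)], is of order
[g j] as long as [g j] dominates the error [s j], and the total loss in that
scale is at most [v 0 `^ (1 - p)].  In the remaining case [g j] is at most the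
summable [s j]. *)
Lemma kl_sum_le (R : realType) (p c K : R) (v g s : nat -> R) (n : nat) :
    0 < p < 1 -> 0 < c -> 0 < K ->
    (forall j, 0 <= v j) -> (forall j, 0 <= g j) -> (forall j, 0 <= s j) ->
    (forall j, v j.+1 + c * g j ^+ 2 <= v j) ->
    (forall j, v j `^ p <= K * (g j + s j)) ->
  \sum_(0 <= j < n) g j <=
    \sum_(0 <= j < n) s j + 2 * K / ((1 - p) * c) * v 0%N `^ (1 - p).
Proof.
move=> p01 c0 K0 v0 g0 s0 vdec vp.
have q0 : 0 < 1 - p by case/andP: p01; rewrite subr_gt0.
set k := 2 * K / _; set psi := fun j => v j `^ (1 - p).
have k0 : 0 < k by rewrite divr_gt0 ?mulr_gt0.
have step j : g j <= s j + k * (psi j - psi j.+1).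
  have vj : v j.+1 <= v j.
    by apply: le_trans (vdec j); rewrite lerDl mulr_ge0 ?sqr_ge0 ?ltW.
  have psi0 : 0 <= psi j - psi j.+1.
    by rewrite subr_ge0 ge0_ler_powR ?nnegrE// ltW.
  have [gs|sg] := leP (g j) (s j).
    by rewrite (le_trans gs)// lerDl mulr_ge0// ltW.
  have gpos : 0 < g j by rewrite (le_lt_trans _ sg).
  rewrite (le_trans _ (ler_wpDl (s0 j) (lexx _)))//.
  have H1 : (1 - p) * (c * g j ^+ 2) <= (1 - p) * (v j - v j.+1).
    by rewrite ler_pM2l//; have := vdec j; lra.
  have H2 := powR_concave_diff p01 (v0 j) (v0 j.+1).
  have H3 : v j `^ p * (psi j - psi j.+1) <=
      K * (2 * g j) * (psi j - psi j.+1).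
    apply: ler_wpM2r => //; apply: le_trans (vp j) _.
    by rewrite ler_pM2l//; lra.
  have H4 := le_trans H1 (le_trans H2 H3).
  rewrite /k -mulrA [_^-1 * _]mulrC mulrA ler_pdivlMr ?mulr_gt0//.
  rewrite -(ler_pM2l gpos); lra.
apply: (@le_trans _ _ (\sum_(0 <= j < n) (s j + k * (psi j - psi j.+1)))).
  by apply: ler_sum => j _; exact: step.
rewrite big_split/= lerD2l -mulr_sumr ler_pM2l//.
rewrite (telescope_sumr_eq (fun j => - psi j))//; last first.
  by move=> j _; rewrite opprK addrC.
by rewrite opprK addrC gerBl powR_ge0.
Qed.

(** A majorant of [\sum_(i >= j) C * i.+2 `^ (- q)] whose decrements dominate
the terms of the series. *)
Definition tail_bound (R : realType) (C q : R) (j : nat) : R :=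
  C / (q - 1) * j.+1%:R `^ (1 - q).

Section perturbed_descent.
Variables (R : realType) (u g : nat -> R) (c C q m : R).
Hypotheses (c_gt0 : 0 < c) (C_ge0 : 0 <= C) (q_gt1 : 1 < q).
Hypothesis g_ge0 : forall j, 0 <= g j.
Hypothesis u_ge : forall j, m <= u j.
Hypothesis u_descent :
  forall j, u j.+1 <= u j - c * g j ^+ 2 + C * j.+2%:R `^ (- q).

Let tau := tail_bound C q.
Let w j := u j + tau j.

Let q10 : 0 < q - 1. Proof. by rewrite subr_gt0. Qed.

Lemma tail_bound_ge0 j : 0 <= tau j.
Proof. by rewrite mulr_ge0 ?powR_ge0// divr_ge0// ltW. Qed.

Lemma tail_bound_cvg0 : tau j @[j --> \oo] --> 0.
Proof.
rewrite -[X in _ --> X](mulr0 (C / (q - 1))); apply: cvgM; first exact: cvg_cst.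
by rewrite -opprB; exact: powRN_natS_cvg0.
Qed.

(** The decrement of [tau] pays for the error term in the descent of [u]. *)
Lemma lyapunov_descent j : w j.+1 + c * g j ^+ 2 <= w j.
Proof.
have := u_descent j.
have := ler_wpM2l (divr_ge0 C_ge0 (ltW q10)) (powRN_telescope j q_gt1).
by rewrite mulrA divfK ?gt_eqF// mulrBr /w /tau /tail_bound; lra.
Qed.

Let w_nincr : nonincreasing_seq w.
Proof.
apply/nonincreasing_seqP => j; apply: le_trans (lyapunov_descent j).
by rewrite lerDl mulr_ge0 ?sqr_ge0// ltW.
Qed.

Let w_lb : has_lbound (range w).
Proof. by exists m => _ [j _ <-]; rewrite ler_wpDr ?tail_bound_ge0. Qed.

Lemma perturbed_descent_cvg : u j @[j --> \oo] --> limn w.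
Proof.
have -> : u = w - tau by apply/funext => j; rewrite /w !fctE addrK.
rewrite -[X in _ --> X]subr0; apply: cvgB tail_bound_cvg0.
exact: nonincreasing_is_cvgn.
Qed.

Lemma perturbed_descent_slope_cvg0 : g j @[j --> \oo] --> 0.
Proof.
have wcvg : cvgn w := nonincreasing_is_cvgn w_nincr w_lb.
have dw : (w j - w j.+1) @[j --> \oo] --> limn w - limn w.
  by apply: cvgB => //; move: wcvg; rewrite -(cvg_shiftS w).
have {}dw : (w j - w j.+1) / c @[j --> \oo] --> 0.
  by rewrite -[X in _ --> X](mul0r c^-1) -(subrr (limn w)); apply: cvgMr_tmp.
apply/cvgr0Pnorm_lt => e e0.
near=> j; rewrite ger0_norm//.
have wj : (w j - w j.+1) / c < e ^+ 2.
  by near: j; apply: cvgr_lt dw _ _; rewrite exprn_gt0.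
rewrite ltr_pdivrMr// in wj.
have : g j ^+ 2 < e ^+ 2.
  by rewrite -(ltr_pM2r c_gt0); have := lyapunov_descent j; lra.
by rewrite ltr_pXn2r ?nnegrE ?(ltW e0).
Unshelve. all: by end_near. Qed.

Let powR_add_le (p a b : R) : 0 <= p -> 0 <= a -> 0 <= b ->
  (a + b) `^ p <= (2 * a) `^ p + (2 * b) `^ p.
Proof.
move=> p0; wlog : a b / a <= b => [H|ab] a0 b0.
  have [ab|/ltW ba] := leP a b; first exact: H.
  by rewrite addrC [leRHS]addrC; exact: H.
by rewrite ler_wpDl ?powR_ge0// ge0_ler_powR ?nnegrE//; lra.
Qed.

(** The exponent [q - 1] of the tails competes with the Lojasiewicz exponent:
[mu < q - 1] is exactly what makes the [mu]-th root of [tail_bound] summable. *)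
Lemma perturbed_descent_summable (mu K : R) (J : nat) :
    1 < mu -> mu < q - 1 -> 0 <= K ->
    (forall j, (J <= j)%N -> `|u j - limn w| <= K * g j `^ mu) ->
  exists S, forall n, \sum_(0 <= j < n) g j <= S.
Proof.
move=> mu1 muq K0 HK.
have mu0 : 0 < mu by lra.
pose p := mu^-1; have p0 : 0 < p by rewrite invr_gt0.
have p01 : 0 < p < 1 by rewrite p0/= invf_lt1.
pose v j := w (J + j)%N - limn w.
pose s j : R := j.+1%:R `^ (- ((q - 1) * p)).
(* the summand 1 keeps k positive when K = C = 0 *)
pose k := (2 * K) `^ p + (2 * (C / (q - 1))) `^ p + 1.
have Cq0 : 0 <= C / (q - 1) by rewrite divr_ge0// ltW.
have k0 : 0 < k by rewrite ltr_wpDl ?addr_ge0 ?powR_ge0.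
have qp1 : 1 < (q - 1) * p by rewrite ltr_pdivlMr// mul1r.
have v0 j : 0 <= v j.
  by rewrite subr_ge0 nonincreasing_cvgn_ge//; exact: nonincreasing_is_cvgn.
have vdec j : v j.+1 + c * g (J + j)%N ^+ 2 <= v j.
  by rewrite /v addnS; have := lyapunov_descent (J + j); lra.
(* tau is nonincreasing, which replaces tau (J + j) by tau j *)
have vp j : v j `^ p <= k * (g (J + j)%N + s j).
  have vE : v j <= K * g (J + j)%N `^ mu + C / (q - 1) * j.+1%:R `^ (1 - q).
    rewrite /v /w addrAC lerD//.
      by apply: le_trans (ler_norm _) _; rewrite HK ?leq_addr.
    rewrite /tau /tail_bound ler_wpM2l// -opprB !powRN lef_pV2 ?posrE ?powR_gt0//.
    by rewrite ge0_ler_powR ?nnegrE// ?ler_nat ?ltnS ?leq_addl// ltW.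
  have Kg : 0 <= K * g (J + j)%N `^ mu by rewrite mulr_ge0 ?powR_ge0.
  have Ct : 0 <= C / (q - 1) * j.+1%:R `^ (1 - q) by rewrite mulr_ge0 ?powR_ge0.
  have := ge0_ler_powR (ltW p0) (v0 j) (addr_ge0 Kg Ct) vE.
  move/le_trans; apply; apply: le_trans (powR_add_le (ltW p0) Kg Ct) _.
  have powR2M a b : 0 <= a -> 0 <= b -> (2 * (a * b)) `^ p = (2 * a) `^ p * b `^ p.
    by move=> a0 b0; rewrite mulrA powRM// mulr_ge0.
  rewrite (powR2M K) ?powR_ge0// (powR2M (C / (q - 1))) ?powR_ge0//.
  rewrite -(powRrM (g (J + j)%N)) mulfV ?gt_eqF// powRr1//.
  have -> : (j.+1%:R `^ (1 - q)) `^ p = s j.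
    by rewrite -powRrM /s; congr (_ `^ _); ring.
  have X0 := powR_ge0 (2 * K) p; have Y0 := powR_ge0 (2 * (C / (q - 1))) p.
  by rewrite mulrDr; apply: lerD; rewrite ler_wpM2r ?powR_ge0// /k; lra.
have sS n : \sum_(0 <= j < n) s j <= 1 + ((q - 1) * p - 1)^-1.
  case: n => [|n].
    by rewrite big_geq// addr_ge0// invr_ge0 subr_ge0 ltW.
  by rewrite big_nat_recl// {1}/s powR1 lerD2l sum_powRN_le.
(* the Lojasiewicz inequality is available from J on, so the first J terms are
   added to the bound as they are *)
exists (\sum_(0 <= j < J) g j + (1 + ((q - 1) * p - 1)^-1 +
   2 * k / ((1 - p) * c) * v 0%N `^ (1 - p))) => n.
apply: (@le_trans _ _ (\sum_(0 <= j < J + n) g j)).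
  by rewrite [leRHS](big_cat_nat (leq0n n) (leq_addl J n))/= lerDl sumr_ge0.
rewrite (big_cat_nat (leq0n J) (leq_addr n J))/= lerD2l.
rewrite -{1}[J]add0n big_addn addKn.
rewrite (eq_bigr (fun j => g (J + j)%N)); last by move=> j _; rewrite addnC.
apply: le_trans (@kl_sum_le _ p c k v (fun j => g (J + j)%N) s n
  _ _ _ _ _ _ _ _) _ => //.
  by move=> j; exact: powR_ge0.
by rewrite lerD2r.
Qed.

End perturbed_descent.

(** * Gradients of row-vector functions *)

Section rows.
Variables (R : realType) (d : nat).
Implicit Types x y : 'rV[R]_d.

Definition dotv x y : R := \sum_(i < d) x 0 i * y 0 i.

Lemma normr_coord_le x i : `|x 0 i| <= `|x|.
Proof.
by rewrite [leRHS]/Num.norm/= mx_normrE; apply/bigmax_geP; right; exists (0, i).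
Qed.

Lemma rV_norm_le x (M : R) : 0 <= M -> (forall i, `|x 0 i| <= M) -> `|x| <= M.
Proof.
move=> M0 xM; rewrite [leLHS]/Num.norm/= mx_normrE; apply/bigmax_leP.
by split=> // -[i j] _; rewrite ord1.
Qed.

Lemma normr_le_enorm x : `|x| <= enorm x.
Proof.
apply: rV_norm_le => [|i]; first exact: sqrtr_ge0.
rewrite -sqrtr_sqr ler_wsqrtr// (bigD1 i)//= lerDl.
by apply: sumr_ge0 => j _; exact: sqr_ge0.
Qed.

Lemma enorm_le_normr x : enorm x <= d%:R * `|x|.
Proof.
rewrite -[leRHS]ger0_norm ?mulr_ge0// -sqrtr_sqr ler_wsqrtr//.
apply: (@le_trans _ _ (\sum_(i < d) `|x| ^+ 2)).
  apply: ler_sum => i _; rewrite -real_normK ?num_real//.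
  by rewrite lerXn2r ?nnegrE// normr_coord_le.
rewrite sumr_const card_ord -[X in X <= _]mulr_natl exprMn ler_wpM2r ?sqr_ge0//.
by rewrite expr2 -natrM ler_nat; case: (d) => // k; rewrite leq_pmulr.
Qed.

Lemma normr_dotv_le x y : `|dotv x y| <= d%:R * `|x| * `|y|.
Proof.
rewrite (le_trans (ler_norm_sum _ _ _))//.
apply: (@le_trans _ _ (\sum_(i < d) `|x| * `|y|)).
  by apply: ler_sum => i _; rewrite normrM ler_pM// normr_coord_le.
by rewrite sumr_const card_ord -[leLHS]mulr_natl mulrA.
Qed.

Lemma sqr_normr_le_dotv x : `|x| ^+ 2 <= dotv x x.
Proof.
have dE : dotv x x = enorm x ^+ 2.
  rewrite sqr_sqrtr; last by apply: sumr_ge0 => i _; exact: sqr_ge0.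
  by apply: eq_bigr => i _; rewrite expr2.
by rewrite dE lerXn2r ?nnegrE ?sqrtr_ge0// normr_le_enorm.
Qed.

Lemma dotvDr x y z : dotv x (y + z) = dotv x y + dotv x z.
Proof. by rewrite -big_split; apply: eq_bigr => i _; rewrite mxE mulrDr. Qed.

Lemma dotvBl x y z : dotv (x - y) z = dotv x z - dotv y z.
Proof. by rewrite -sumrB; apply: eq_bigr => i _; rewrite !mxE mulrBl. Qed.

Lemma dotvZr (a : R) x y : dotv x (a *: y) = a * dotv x y.
Proof. by rewrite mulr_sumr; apply: eq_bigr => i _; rewrite !mxE mulrCA. Qed.

(** Differentiability, and not only the existence of partial derivatives, is
what makes the directional derivatives linear in [v]. *)
Lemma derive_gradient (f : 'rV[R]_d -> R) x v :
  differentiable f x -> 'D_v f x = dotv (gradient f x) v.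
Proof.
move=> df; rewrite deriveE// {1}(row_sum_delta v) linear_sum.
by apply: eq_bigr => i _; rewrite linearZ/= mxE deriveE// mulrC.
Qed.

Lemma gradient_mvt (f : 'rV[R]_d -> R) x v :
    (forall y, differentiable f y) ->
  exists2 s : R, 0 <= s <= 1 & f (x + v) - f x = dotv (gradient f (x + s *: v)) v.
Proof.
move=> df; pose phi (s : R) : R := f (x + s *: v).
have line (s : R) : (fun h : R => h^-1 *: (phi (h *: 1 + s) - phi s)) =
    (fun h : R => h^-1 *: (f (h *: v + (x + s *: v)) - f (x + s *: v))).
  apply/funext => h; rewrite /phi; congr (_ *: (f _ - _)).
  by rewrite scalerDl [h *: 1]mulr1 addrCA.
have dphi (s : R) : is_derive s 1 phi (dotv (gradient f (x + s *: v)) v).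
  apply: DeriveDef.
    by rewrite /derivable line; exact: diff_derivable.
  by rewrite -derive_gradient// /derive line.
have [|s s01] := @MVT_segment _ phi _ 0 1 ler01 (fun s _ => dphi s).
  by apply: derivable_within_continuous => s _; exact: ex_derive.
rewrite /phi scale1r scale0r addr0 subr0 mulr1 => fE.
by exists s => //; move: s01; rewrite in_itv.
Qed.

(** The constant is cruder than the usual [L / 2]: the mean value theorem is used
at one intermediate point in place of an integral, and passing from the dot
product to the sup norm costs the factor [d]. *)
Lemma lipschitz_descent (f : 'rV[R]_d -> R) (L : R) (K : set 'rV[R]_d) x v :
    (forall y, differentiable f y) -> 0 <= L ->
    (forall y z, K y -> K z -> `|gradient f y - gradient f z| <= L * `|y - z|) ->
    (forall s, 0 <= s <= 1 -> K (x + s *: v)) ->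
  f (x + v) - f x <= dotv (gradient f x) v + d%:R * L * `|v| ^+ 2.
Proof.
move=> df L0 Lip Kseg; have [s s01 ->] := gradient_mvt x v df.
rewrite -lerBlDl -dotvBl; apply: le_trans (ler_norm _) _.
apply: le_trans (normr_dotv_le _ _) _.
rewrite expr2 mulrA ler_wpM2r// -mulrA ler_wpM2l//.
have Kx : K x by rewrite -[x]addr0 -(scale0r v); apply: Kseg; rewrite lexx ler01.
apply: le_trans (Lip _ _ (Kseg _ s01) Kx) _.
case/andP: s01 => s0 s1.
by rewrite addrC addKr normrZ ger0_norm// ler_wpM2l// ler_piMl.
Qed.

End rows.

Section local_lipschitz.
Variables (R : realType) (d : nat).
Variable g : 'rV[R]_d -> 'rV[R]_d.
Hypothesis g_lip : locally_lipschitz g.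

Lemma locally_lipschitz_ball (x : 'rV[R]_d) : exists e M : R,
  [/\ 0 < e, 0 < M & forall y z, `|x - y| < e -> `|x - z| < e ->
    `|g y - g z| <= M * `|y - z|].
Proof.
have [U Ux] := g_lip x.
move=> /pinfty_ex_gt0[M M0 LM].
have /nbhs_ballP[e /= e0 eU] := Ux.
exists e, M; split => // y z xy xz.
have := LM (y, z); rewrite /self_sub/=; apply; split; apply: eU;
  by rewrite -ball_normE.
Qed.

Lemma locally_lipschitz_continuous : continuous g.
Proof.
move=> x; have [e [M [e0 M0 gM]]] := locally_lipschitz_ball x.
apply/(@cvgrPdist_lt _ _ _ (nbhs x) (nbhs_filter x) g (g x)) => eps eps0.
apply/nbhs_ballP.
exists (Num.min e (eps / M)); first by rewrite /= lt_min e0 divr_gt0.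
move=> y; rewrite -ball_normE/= lt_min => /andP[xy].
rewrite ltr_pdivlMr// mulrC; apply: le_lt_trans.
by apply: gM => //; rewrite subrr normr0.
Qed.

(** Pairs of nearby points are handled by a local Lipschitz constant, pairs at
distance at least [e / 2] by the boundedness of [g]; compactness makes both
uniform. *)
Lemma locally_lipschitz_compact (K : set 'rV[R]_d) : compact K ->
  exists2 L : R, 0 < L & forall y z, K y -> K z -> `|g y - g z| <= L * `|y - z|.
Proof.
move=> cK.
have [B B0 gB] : exists2 B : R, 0 < B & forall y, K y -> `|g y| <= B.
  have /compact_bounded/pinfty_ex_gt0[B B0 gB] : compact (g @` K).
    apply: continuous_compact => //; apply: continuous_subspaceT.
    exact: locally_lipschitz_continuous.
  by exists B => // y Ky; apply: gB; exists y.
pose P (L : R) y := K y -> forall z, K z -> `|g y - g z| <= L * `|y - z|.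
have : \forall L \near +oo, K `<=` P L.
  move/compact_near_coveringP : cK => cK; apply: cK => x Kx.
  have [e [M [e0 M0 gM]]] := locally_lipschitz_ball x.
  have e20 : 0 < e / 2 by rewrite divr_gt0.
  exists (ball x (e / 2), [set L | Num.max M (2 * B / (e / 2)) <= L]).
    split; first exact: nbhsx_ballx.
    by apply: nbhs_pinfty_ge; rewrite num_real.
  move=> [y L] /= []; rewrite -ball_normE/= => xy; rewrite ge_max => /andP[ML BL].
  move=> Ky z Kz; have [yz|yz] := ltP (`|y - z|) (e / 2).
    apply: (@le_trans _ _ (M * `|y - z|)); last by rewrite ler_wpM2r.
    apply: gM; first by rewrite (lt_le_trans xy)//; lra.
    by rewrite -(subrKA y) (le_lt_trans (ler_normD _ _))//; lra.
  apply: (@le_trans _ _ (2 * B)).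
    by rewrite (le_trans (ler_normB _ _))// mulr2n mulrDl !mul1r lerD// gB.
  rewrite -ler_pdivrMr//; last by rewrite (lt_le_trans e20).
  apply: le_trans BL; rewrite ler_wpM2l ?mulr_ge0 ?(ltW B0)//.
  by rewrite lef_pV2 ?posrE// (lt_le_trans e20).
by move=> /pinfty_ex_gt0[L L0 KL]; exists L => // y z Ky; exact: KL.
Qed.

End local_lipschitz.

(** * Bounded suprema and series of increments *)

Lemma ereal_sup_lt_pinfty (T : Type) (R : realType) (u : T -> R) (V : set T) :
    (ereal_sup [set (u n)%:E | n in V] < +oo)%E ->
  exists B, forall n, V n -> u n <= B.
Proof.
have uV n : V n -> ((u n)%:E <= ereal_sup [set (u n)%:E | n in V])%E.
  by move=> Vn; apply: ereal_sup_ubound; exists n.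
case: ereal_sup uV => [b| |] uV //= _.
  by exists b => n /uV; rewrite lee_fin.
by exists 0 => n /uV; rewrite leeNy_eq.
Qed.

Lemma limn_esup_lt_pinfty (R : realType) (u : nat -> R) :
    (limn_esup (fun n => (u n)%:E) < +oo)%E ->
  exists N B, forall n, (N <= n)%N -> u n <= B.
Proof.
move=> /ereal_inf_lt[_ [V [N _ NV] <-]] /ereal_sup_lt_pinfty[B uB].
by exists N, B => n Nn; apply: uB; exact: (NV n Nn).
Qed.

Lemma summable_increments_cvg (R : realType) (V : completeNormedModType R)
    (x : nat -> V) (D : nat -> R) (S : R) :
    (forall j, `|x j.+1 - x j| <= D j) ->
    (forall n, \sum_(0 <= j < n) D j <= S) ->
  cvgn x.
Proof.
move=> xD DS.
have /normed_cvg xc : cvgn [normed series (fun j => x j.+1 - x j)].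
  apply: nondecreasing_is_cvgn.
    by apply: nondecreasing_series => ? _ _; exact: normr_ge0.
  exists S => _ [n _ <-]; apply: le_trans (DS n).
  by apply: ler_sum => j _; exact: xD.
have -> : x = (fun n => series (fun j => x j.+1 - x j) n + x 0%N).
  by apply/funext => n; rewrite /series/= telescope_sumr// subrK.
by apply: is_cvgD => //; exact: is_cvg_cst.
Qed.

(** Joins the completeness and the norm of matrices over the reals, so that
absolutely convergent series of row vectors converge. *)
HB.instance Definition _ (R : realType) (m n : nat) := Complete.on 'M[R]_(m, n).

(** * One block of iterations *)

(** Summation by parts: nonincreasing weights let the partial sums of [w i *: y i]
inherit the bound on the partial sums of [y], at the price of the first weight.
The induction keeps the boundary term [w k *: \sum y] apart, which makes the
constant exactly [B]. *)
Lemma abel_norm_le (R : realType) (V : normedModType R) (w : nat -> R)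
    (y : nat -> V) (n m : nat) (B : R) :
    (forall i, (n <= i)%N -> 0 <= w i) ->
    (forall i, (n <= i)%N -> w i.+1 <= w i) ->
    (forall k, (n <= k < m)%N -> `|\sum_(n <= i < k.+1) y i| <= B) ->
  forall k, (n <= k < m)%N -> `|\sum_(n <= i < k.+1) w i *: y i| <= B * w n.
Proof.
move=> w0 wdec yB.
have H j : (n + j < m)%N ->
    `|\sum_(n <= i < (n + j).+1) w i *: y i
      - w (n + j)%N *: \sum_(n <= i < (n + j).+1) y i|
    <= B * (w n - w (n + j)%N).
  elim: j => [|j IH] jm.
    by rewrite addn0 !big_nat1 !subrr mulr0 normr0.
  have jm' : (n + j < m)%N by rewrite (leq_trans _ jm)// addnS ltnW.
  have nj : (n <= (n + j).+1)%N by rewrite -addnS leq_addr.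
  rewrite addnS !(big_nat_recr (n + j).+1 n _ nj)/=.
  set A := \sum_(n <= i < (n + j).+1) w i *: y i in IH *.
  set S := \sum_(n <= i < (n + j).+1) y i in IH *.
  have -> : A + w (n + j).+1 *: y (n + j).+1
      - w (n + j).+1 *: (S + y (n + j).+1) =
      (A - w (n + j)%N *: S) + (w (n + j)%N - w (n + j).+1) *: S.
    by rewrite scalerDr opprD addrACA subrr addr0 scalerBl addrA subrK.
  rewrite (le_trans (ler_normD _ _))//.
  have -> : w n - w (n + j).+1 =
    (w n - w (n + j)%N) + (w (n + j)%N - w (n + j).+1) by rewrite subrKA.
  have dw : 0 <= w (n + j)%N - w (n + j).+1 by rewrite subr_ge0 wdec ?leq_addr.
  rewrite mulrDr lerD ?IH// normrZ ger0_norm// mulrC ler_wpM2r//.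
  by apply: yB; rewrite leq_addr.
move=> k /andP[nk km]; have := H (k - n)%N; rewrite subnKC// => /(_ km) Hk.
rewrite -[X in `|X|](subrK (w k *: \sum_(n <= i < k.+1) y i)).
rewrite (le_trans (ler_normD _ _))// -[w n in leRHS](subrK (w k)) mulrDr lerD//.
by rewrite normrZ ger0_norm ?w0// mulrC ler_wpM2r ?w0// yB// nk.
Qed.

Section block.
Variables (R : realType) (d : nat) (f : 'rV[R]_d -> R).
Variables (alpha : nat -> R) (theta xi : nat -> 'rV[R]_d).
Variables (rho L T eps : R) (n m : nat).
Let h := gradient f.
Hypothesis f_diff : forall x, differentiable f x.
Hypothesis alpha_ge0 : forall i, 0 <= alpha i.
Hypothesis theta_rec :
  forall i, theta i.+1 = theta i - alpha i *: (h (theta i) + xi i).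
Hypothesis theta_bnd : forall i, `|theta i| <= rho.
Hypothesis L_ge0 : 0 <= L.
Hypothesis h_lip : forall y z, `|y| <= rho -> `|z| <= rho ->
  `|h y - h z| <= L * `|y - z|.
Hypothesis T_gt0 : 0 < T.
Hypothesis TL : T * L <= 2^-1.
Hypothesis eps_ge0 : 0 <= eps.
Hypothesis nm : (n <= m)%N.
Hypothesis block_le : gamma alpha m - gamma alpha n <= T.
Hypothesis noise_le :
  forall k, (n <= k < m)%N -> `|\sum_(n <= i < k.+1) alpha i *: xi i| <= eps.

Let G := `|h (theta n)|.
Let D := 2 * (T * G + eps).

Let gammaB k : (n <= k)%N -> gamma alpha k - gamma alpha n =
  \sum_(n <= i < k) alpha i.
Proof. by move=> nk; rewrite /gamma (big_cat_nat (leq0n n) nk)/= addrAC subrr add0r. Qed.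

Let block_sum_le k : (n <= k <= m)%N -> \sum_(n <= i < k) alpha i <= T.
Proof.
move=> /andP[nk km]; apply: le_trans block_le; rewrite gammaB//.
by rewrite [leRHS](big_cat_nat nk km)/= lerDl sumr_ge0.
Qed.

Let noise_le0 k : (n <= k <= m)%N -> `|\sum_(n <= i < k) alpha i *: xi i| <= eps.
Proof.
case: k => [|k]; first by rewrite leqn0 => /andP[/eqP -> _]; rewrite big_geq// normr0.
move=> /andP[nk km]; have [/eqP nk1|nk1] := eqVneq n k.+1.
  by rewrite (eqP nk1) big_geq// normr0.
by apply: noise_le; rewrite km andbT -ltnS ltn_neqAle nk1.
Qed.

Let theta_sum k : (n <= k)%N -> theta k - theta n =
  - (gamma alpha k - gamma alpha n) *: h (theta n)
  - \sum_(n <= i < k) alpha i *: (h (theta i) - h (theta n))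
  - \sum_(n <= i < k) alpha i *: xi i.
Proof.
move=> nk; rewrite -[LHS](telescope_sumr theta nk) gammaB// scaleNr scaler_suml.
rewrite -!opprD -!big_split/= -sumrN; apply: eq_bigr => i _.
by rewrite theta_rec [LHS]addrAC subrr add0r -!scalerDr subrKC.
Qed.

Let D_ge0 : 0 <= D.
Proof. by rewrite mulr_ge0// addr_ge0// mulr_ge0 ?normr_ge0 ?(ltW T_gt0). Qed.

Let drift_sum_le k : (n <= k <= m)%N ->
    (forall i, (n <= i < k)%N -> `|theta i - theta n| <= D) ->
  `|\sum_(n <= i < k) alpha i *: (h (theta i) - h (theta n))| <= T * L * D.
Proof.
move=> nkm IH; apply: le_trans (ler_norm_sum _ _ _) _.
apply: (@le_trans _ _ (\sum_(n <= i < k) alpha i * (L * D))).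
  apply: ler_sum_nat => i ik; rewrite normrZ ger0_norm// ler_wpM2l//.
  by apply: le_trans (h_lip _ _) _ => //; rewrite ler_wpM2l// IH.
by rewrite -mulr_suml -mulrA ler_wpM2r ?block_sum_le ?(mulr_ge0 L_ge0 D_ge0).
Qed.

(** A discrete Gronwall estimate by strong induction: as long as the iterates
stay within [D] of [theta n], the gradients differ from [h (theta n)] by at most
[L * D], and [T * L <= 1 / 2] makes the resulting displacement at most [D]
again. *)
Lemma block_drift k : (n <= k <= m)%N -> `|theta k - theta n| <= D.
Proof.
elim/ltn_ind: k => k IH nkm; case/andP: (nkm) => nk km.
rewrite theta_sum// (le_trans (ler_normB _ _))//.
have -> : D = T * G + 2^-1 * D + eps by rewrite /D; field.
rewrite lerD ?noise_le0// (le_trans (ler_normB _ _))// lerD//.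
  rewrite normrZ normrN gammaB// ger0_norm ?sumr_ge0//.
  by rewrite ler_wpM2r// block_sum_le.
apply: le_trans (drift_sum_le nkm _) _; last by rewrite ler_wpM2r.
move=> i /andP[ni ik]; apply: IH => //.
by rewrite ni (leq_trans (ltnW ik) km).
Qed.

Hypothesis block_ge : T / 2 <= gamma alpha m - gamma alpha n.
Hypothesis TdL : d%:R * L * T <= 80^-1.

(** The smallness of [d L T] lets the loss [(T / 2) G^2] of the exact gradient step
absorb all error terms in [G^2] and, by Young's inequality, the term in
[G eps]; half of the loss remains. *)
Lemma block_descent : f (theta m) <= f (theta n) - T / 4 * G ^+ 2
  + (8 * d%:R ^+ 2 / T + 8 * d%:R * L) * eps ^+ 2.
Proof.
set v := theta m - theta n.
have vD : `|v| <= D by apply: block_drift; rewrite nm leqnn.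
have G0 : 0 <= G by exact: normr_ge0.
have seg s : 0 <= s <= 1 -> `|theta n + s *: v| <= rho.
  move=> /andP[s0 s1]; have -> : theta n + s *: v =
      (1 - s) *: theta n + s *: theta m.
    by rewrite /v scalerBr scalerBl scale1r addrA addrAC.
  rewrite (le_trans (ler_normD _ _))// !normrZ !ger0_norm ?subr_ge0//.
  rewrite -[leRHS]mul1r -[X in _ <= X * _](subrK s) [leRHS]mulrDl.
  by rewrite lerD// ler_wpM2l ?subr_ge0.
have := @lipschitz_descent R d f L [set y | `|y| <= rho] (theta n) v f_diff L_ge0
  h_lip seg.
rewrite {1}/v subrKC -/h.
set e := - \sum_(n <= i < m) alpha i *: (h (theta i) - h (theta n))
  - \sum_(n <= i < m) alpha i *: xi i.
have vE : v = - (gamma alpha m - gamma alpha n) *: h (theta n) + e.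
  by rewrite /v theta_sum// /e addrA.
have nmm : (n <= m <= m)%N by rewrite nm leqnn.
have eD : `|e| <= T * L * D + eps.
  rewrite (le_trans (ler_normB _ _))// normrN lerD ?noise_le0//.
  apply: drift_sum_le => // i /andP[ni im]; apply: block_drift.
  by rewrite ni ltnW.
have hv : dotv (h (theta n)) v <=
    - (T / 2 * G ^+ 2) + d%:R * G * (T * L * D + eps).
  rewrite vE dotvDr dotvZr lerD//.
    rewrite mulNr lerN2; apply: ler_pM => //; last exact: sqr_normr_le_dotv.
      by rewrite divr_ge0// ltW.
    exact: sqr_ge0.
  rewrite (le_trans (ler_norm _))// (le_trans (normr_dotv_le _ _))//.
  by rewrite ler_wpM2l// mulr_ge0.
have vD2 : d%:R * L * `|v| ^+ 2 <= d%:R * L * D ^+ 2.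
  by rewrite ler_wpM2l ?mulr_ge0// lerXn2r ?nnegrE.
have d0 : 0 <= d%:R :> R by [].
move=> fD; have {}fD : f (theta m) - f (theta n) <=
    - (T / 2 * G ^+ 2) + d%:R * G * (T * L * D + eps) + d%:R * L * D ^+ 2.
  by lra.
have dG : 0 <= d%:R * G by rewrite mulr_ge0.
(* b1 and b2 control the terms in G^2 and G eps, b3 splits the square of
   D = 2 (T G + eps), and b4 is Young's inequality with weight T / 8 *)
have b1 : d%:R * L * T * (T * G ^+ 2) <= 80^-1 * (T * G ^+ 2).
  by rewrite ler_wpM2r// mulr_ge0 ?sqr_ge0 ?ltW.
have b2 : T * L * (d%:R * G * eps) <= 2^-1 * (d%:R * G * eps).
  by rewrite ler_wpM2r// mulr_ge0.
have b3 : 0 <= d%:R * L * (T * G - eps) ^+ 2.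
  by rewrite mulr_ge0 ?sqr_ge0// mulr_ge0.
have b4 : 2 * (d%:R * G * eps) <= T / 8 * G ^+ 2 + 8 * d%:R ^+ 2 / T * eps ^+ 2.
  rewrite -subr_ge0.
  have -> : T / 8 * G ^+ 2 + 8 * d%:R ^+ 2 / T * eps ^+ 2 - 2 * (d%:R * G * eps)
    = (T * G - 8 * d%:R * eps) ^+ 2 / (8 * T) by field; rewrite gt_eqF.
  by rewrite divr_ge0 ?sqr_ge0 ?mulr_ge0 ?ltW.
rewrite mulrDl; move: fD b1 b2 b3 b4; rewrite /D.
set X := 8 * d%:R ^+ 2 / T * _; move: X => X.
nra.
Qed.

End block.

(** * The sequence of blocks *)

Definition block_time (R : realType) (alpha : nat -> R) (T : R) (N j : nat) :=
  iter j (fun n => horizon alpha n T) N.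

Section block_times.
Variables (R : realType) (alpha : nat -> R) (T : R) (N : nat).
Hypothesis alpha_gt0 : forall i, 0 < alpha i.
Hypothesis gamma_oo : gamma alpha n @[n --> \oo] --> +oo.
Hypothesis T_gt0 : 0 < T.
Hypothesis alpha_small : forall n, (N <= n)%N -> alpha n <= T / 2.
Hypothesis gammaN : T <= gamma alpha N.

Let nj := block_time alpha T N.

Let gammaS n : gamma alpha n.+1 = gamma alpha n + alpha n.
Proof. by rewrite /gamma big_nat_recr. Qed.

(** The lower bound holds because one more step, of size at most [T / 2], would
overshoot [T]. *)
Lemma horizon_step n : (N <= n)%N ->
  [/\ (n < horizon alpha n T)%N,
      T / 2 <= gamma alpha (horizon alpha n T) - gamma alpha n &
      gamma alpha (horizon alpha n T) - gamma alpha n <= T].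
Proof.
move=> Nn; have [nh hT hmax] := horizonP n alpha_gt0 gamma_oo (ltW T_gt0).
set m := horizon alpha n T in nh hT hmax *.
split => //.
  apply: hmax => //; rewrite gammaS addrAC subrr add0r.
  by have := alpha_small Nn; move: T_gt0; lra.
rewrite leNgt; apply/negP => mT.
suff : (m.+1 <= m)%N by rewrite ltnn.
apply: hmax; first exact: leq_trans nh _.
rewrite gammaS; have := alpha_small (leq_trans Nn nh); lra.
Qed.

Lemma block_time_ge j : (N <= nj j)%N.
Proof.
elim: j => // j IH; have [lt_h _ _] := horizon_step IH.
exact: leq_trans IH (ltnW lt_h).
Qed.

Lemma block_time_mono i j : (i <= j)%N -> (nj i <= nj j)%N.
Proof.
apply: (@homo_leq _ nj leq leqnn leq_trans) => k.
by have [/ltnW] := horizon_step (block_time_ge k).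
Qed.

(** The shift [j.+2], which matches the terms of [powRN_telescope], is
affordable because the blocks start at a time [gamma alpha N >= T]. *)
Lemma gamma_block_time_ge j : T / 2 * j.+2%:R <= gamma alpha (nj j).
Proof.
elim: j => [|j IH]; first by rewrite divfK.
have [_ + _] := horizon_step (block_time_ge j).
by rewrite -[j.+3%:R]natr1 -/(nj j.+1); move: IH; lra.
Qed.

Lemma block_time_cover n : (N <= n)%N -> exists j, (nj j <= n < nj j.+1)%N.
Proof.
have step j : (nj j < nj j.+1)%N by have [] := horizon_step (block_time_ge j).
elim: n => [|n IH].
  by move=> N0; exists 0%N; rewrite N0 (leq_ltn_trans _ (step 0%N)).
rewrite leq_eqVlt => /orP[/eqP <-|]; first by exists 0%N; rewrite leqnn (step 0%N).
rewrite ltnS => /IH[j /andP[jn nj1]].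
have [lt|ge] := ltnP n.+1 (nj j.+1); first by exists j; rewrite (leq_trans jn).
by exists j.+1; rewrite ge (leq_ltn_trans nj1)// step.
Qed.

End block_times.

Lemma le_max_weighted_sum (R : realType) (d : nat) (alpha : nat -> R) (r : R)
    (x : nat -> 'rV[R]_d) (t : R) (n k : nat) : (n <= k < horizon alpha n t)%N ->
  `|\sum_(n <= i < k.+1) (alpha i * gamma alpha i `^ r) *: x i|
    <= max_weighted_sum alpha r x t n.
Proof.
move=> nk; apply: le_trans (normr_le_enorm _) _.
by rewrite /max_weighted_sum; apply: (le_bigmax_seq _ k) => //; rewrite mem_index_iota.
Qed.

(** The weights [gamma alpha i `^ r] of the noise condition are undone by the
nonincreasing weights [gamma alpha i `^ (- r)]. *)
Lemma noise_sum_le (R : realType) (d : nat) (alpha : nat -> R) (r t B : R)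
    (x : nat -> 'rV[R]_d) (n : nat) :
    (forall i, 0 < alpha i) -> 0 <= r -> 0 < gamma alpha n ->
    max_weighted_sum alpha r x t n <= B ->
  forall k, (n <= k < horizon alpha n t)%N ->
    `|\sum_(n <= i < k.+1) alpha i *: x i| <= B * gamma alpha n `^ (- r).
Proof.
move=> alpha0 r0 gn xB k nk.
have gmon i j : (i <= j)%N -> gamma alpha i <= gamma alpha j.
  move=> ij; rewrite /gamma (big_cat_nat _ ij)//= lerDl.
  by apply: sumr_ge0 => l _; exact: ltW.
have gpos i : (n <= i)%N -> 0 < gamma alpha i.
  by move=> ni; exact: lt_le_trans gn (gmon _ _ ni).
rewrite (eq_big_nat _ _ (F2 := fun i => gamma alpha i `^ (- r) *:
    ((alpha i * gamma alpha i `^ r) *: x i))); last first.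
  move=> i /andP[ni _]; rewrite scalerA powRN mulrCA mulVf ?mulr1//.
  by rewrite gt_eqF// powR_gt0// gpos.
apply: (@abel_norm_le _ _ _ _ n (horizon alpha n t)) => // [i _|i ni|l nl].
- exact: powR_ge0.
- rewrite !powRN lef_pV2 ?posrE ?powR_gt0 ?gpos//; last exact: leqW.
  by rewrite ge0_ler_powR ?nnegrE ?(ltW (gpos _ _))//; [exact: leqW|exact: gmon].
- exact: le_trans (le_max_weighted_sum r x nl) xB.
Qed.

(** * Convergence of a trajectory *)

Lemma compact_norm_ball (R : realType) (d : nat) (rho : R) :
  compact [set y : 'rV[R]_d | `|y| <= rho].
Proof.
apply: bounded_closed_compact.
  by exists rho; split; [exact: num_real|move=> M /ltW rM y /= /le_trans; apply].
have -> : [set y : 'rV[R]_d | `|y| <= rho] = closed_ball_ Num.norm 0 rho.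
  by apply/funext => y; rewrite /closed_ball_/= sub0r normrN.
exact: closed_closed_ball_.
Qed.

Lemma powR_exponent_anti (R : realType) (mu nu a : R) :
  0 <= a <= 1 -> 0 < nu -> nu <= mu -> a `^ mu <= a `^ nu.
Proof.
move=> /andP[a0 a1] nu0 numu; move: a0; rewrite le_eqVlt => /orP[/eqP <-|a0].
  by rewrite !powR0 ?gt_eqF// (lt_le_trans nu0).
by apply: ger_powR => //; rewrite a0.
Qed.

(** The noise [xi] is an arbitrary sequence here, so the almost sure statement
reduces to this one sample point by sample point. *)
Theorem perturbed_gradient_cvg (R : realType) (d : nat) (f : 'rV[R]_d -> R)
    (alpha : nat -> R) (theta xi : nat -> 'rV[R]_d) (r rho : R) :
    (forall x, differentiable f x) ->
    locally_lipschitz (gradient f) ->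
    (forall n, 0 < alpha n) ->
    alpha n @[n --> \oo] --> 0 ->
    gamma alpha n @[n --> \oo] --> +oo ->
    (forall n, theta n.+1 = theta n - alpha n *: (gradient f (theta n) + xi n)) ->
    (forall n, `|theta n| <= rho) ->
    1 < r ->
    (forall t, 0 < t -> exists N B, forall n, (N <= n)%N ->
      max_weighted_sum alpha r xi t n <= B) ->
    (forall a, (f @` [set y | `|y| <= rho]) a -> exists delta mu M : R,
      [/\ 0 < delta, 1 < mu, 0 <= M &
        forall x, `|x| <= rho -> `|f x - a| <= delta ->
          `|f x - a| <= M * enorm (gradient f x) `^ mu]) ->
  exists2 theta_hat, theta n @[n --> \oo] --> theta_hat &
    gradient f theta_hat = 0.
Proof.
move=> f_diff f_lip alpha0 alpha_cvg0 gamma_oo theta_rec theta_bnd r1 noise loja.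
set h := gradient f.
pose K := [set y : 'rV[R]_d | `|y| <= rho].
have cK : compact K := @compact_norm_ball R d rho.
have [L L0 h_lip] := locally_lipschitz_compact f_lip cK.
(* small enough for both smallness conditions on a block, also when d = 0 *)
pose T : R := (80 * (d%:R + 1) * L)^-1.
have d0 : 0 <= d%:R :> R by [].
have T0 : 0 < T by rewrite invr_gt0 !mulr_gt0// ltr_wpDl.
have TL : (d%:R + 1) * L * T = 80^-1.
  by rewrite /T; field; rewrite gt_eqF//= gt_eqF// ltr_wpDl.
have TL2 : T * L <= 2^-1.
  have : 0 <= d%:R * (T * L) by rewrite !mulr_ge0// ltW.
  by move: TL; lra.
have TdL : d%:R * L * T <= 80^-1.
  by rewrite -TL mulrDl mul1r mulrDl lerDl mulr_ge0// ltW.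
have [N1 [B0 noiseB0]] := noise T T0.
(* the absolute value makes the error bounds eps_j nonnegative *)
pose B := `|B0|.
have noiseB n : (N1 <= n)%N -> max_weighted_sum alpha r xi T n <= B.
  by move=> /noiseB0/le_trans; apply; exact: ler_norm.
have [N [N1N alphaN gammaN]] : exists N, [/\ (N1 <= N)%N,
    forall n, (N <= n)%N -> alpha n <= T / 2 & T <= gamma alpha N].
  have : \forall n \near \oo, [/\ (N1 <= n)%N, alpha n <= T / 2 & T <= gamma alpha n].
    near=> n; split; near: n.
    - exact: nbhs_infty_ge.
    - by apply: cvgr_le alpha_cvg0 _ _; rewrite divr_gt0.
    - by move/cvgryPge : gamma_oo; exact.
  move=> [N _ HN]; exists N; split.
  - by have [] := HN N (leqnn N).
  - by move=> n /HN[].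
  - by have [] := HN N (leqnn N).
pose nj := block_time alpha T N.
have step j := horizon_step alpha0 gamma_oo T0 alphaN
  (block_time_ge alpha0 gamma_oo T0 alphaN j).
pose x j := theta (nj j).
pose G j := `|h (x j)|.
pose b := B * (T / 2) `^ (- r).
pose eps j := b * j.+2%:R `^ (- r).
have T20 : 0 < T / 2 by rewrite divr_gt0.
have B_ge0 : 0 <= B by exact: normr_ge0.
have b0 : 0 <= b by rewrite mulr_ge0 ?powR_ge0.
have eps0 j : 0 <= eps j by rewrite mulr_ge0 ?powR_ge0.
have noise_le j k : (nj j <= k < nj j.+1)%N ->
    `|\sum_(nj j <= i < k.+1) alpha i *: xi i| <= eps j.
  have gj := gamma_block_time_ge alpha0 gamma_oo T0 alphaN gammaN j.
  have gj0 : 0 < T / 2 * j.+2%:R by rewrite mulr_gt0.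
  have r0 : 0 <= r by rewrite (le_trans ler01)// ltW.
  have mB : max_weighted_sum alpha r xi T (nj j) <= B.
    by apply: noiseB; rewrite (leq_trans N1N)// block_time_ge.
  move=> njk.
  apply: le_trans (noise_sum_le alpha0 r0 (lt_le_trans gj0 gj) mB njk) _.
  rewrite /eps /b -mulrA ler_wpM2l// -powRM ?(ltW T20)//.
  rewrite !powRN lef_pV2 ?posrE ?powR_gt0//; last exact: lt_le_trans gj0 gj.
  by rewrite ge0_ler_powR ?nnegrE ?(ltW gj0) ?(le_trans (ltW gj0) gj).
have alpha0' i : 0 <= alpha i by exact: ltW.
have drift j k : (nj j <= k <= nj j.+1)%N ->
    `|theta k - x j| <= 2 * (T * G j + eps j).
  have [/ltnW jm _ hT] := step j.
  exact: (block_drift alpha0' theta_rec theta_bnd (ltW L0) h_lip T0 TL2 (eps0 j)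
    jm hT (@noise_le j)).
pose C := 8 * d%:R ^+ 2 / T + 8 * d%:R * L.
have C0 : 0 <= C.
  by rewrite addr_ge0 ?divr_ge0 ?mulr_ge0 ?sqr_ge0 ?(ltW T0) ?(ltW L0).
have descent j : f (x j.+1) <=
    f (x j) - T / 4 * G j ^+ 2 + C * b ^+ 2 * j.+2%:R `^ (- (2 * r)).
  have [/ltnW jm hT2 hT] := step j.
  have := block_descent f_diff alpha0' theta_rec theta_bnd (ltW L0) h_lip T0 TL2
    (eps0 j) jm hT (@noise_le j) hT2 TdL.
  have -> : eps j ^+ 2 = b ^+ 2 * j.+2%:R `^ (- (2 * r)).
    rewrite /eps exprMn; congr (_ * _); rewrite -powR_mulrn ?powR_ge0// -powRrM.
    by congr (_ `^ _); ring.
  by rewrite -[C * _ * _]mulrA.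
have f_cont : continuous f by move=> y; exact: differentiable_continuous.
have cfK : compact (f @` K).
  by apply: continuous_compact => //; exact: continuous_subspaceT.
have [m fm] : exists m, forall j, m <= f (x j).
  have /compact_bounded/pinfty_ex_gt0[m _ mK] := cfK.
  exists (- m) => j; have := mK (f (x j)).
  rewrite /= ler_norml => /(_ _)/andP[]//.
  by exists (x j) => //; exact: theta_bnd.
have q1 : 1 < 2 * r by lra.
have T40 : 0 < T / 4 by rewrite divr_gt0.
have Cb0 : 0 <= C * b ^+ 2 by rewrite mulr_ge0 ?sqr_ge0.
have G0 j : 0 <= G j by exact: normr_ge0.
have ul := perturbed_descent_cvg T40 Cb0 q1 fm descent.
have Gcvg := perturbed_descent_slope_cvg0 T40 Cb0 q1 G0 fm descent.
have summ := perturbed_descent_summable T40 Cb0 q1 G0 fm descent.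
set l := limn _ in ul summ.
have fKl : (f @` K) l.
  apply: (closed_cvg (f @` K) (compact_closed (@Rhausdorff R) cfK) _ _ ul).
  by apply: nearW => j; exists (x j) => //; exact: theta_bnd.
have [delta [mu [M [delta0 mu1 M0 lojal]]]] := loja _ fKl.
(* nu < 2 r - 1, and a ^ mu <= a ^ nu for the small gradient norms a *)
pose nu := Num.min mu r.
have nu1 : 1 < nu by rewrite lt_min mu1.
have [S GS] : exists S, forall n, \sum_(0 <= j < n) G j <= S.
  have [J _ HJ] : \forall j \near \oo,
      `|f (x j) - l| <= delta /\ d%:R * G j <= 1.
    near=> j; split; near: j.
      exact: cvgr_distC_le _ _ ul _ delta0.
    have dG : d%:R * G j @[j --> \oo] --> (d%:R * 0 : R).
      by apply: cvgM => //; exact: cvg_cst.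
    by apply: cvgr_le dG _ _; rewrite mulr0.
  apply: (summ nu (M * d%:R `^ nu) J) => //.
  - have : nu <= r by rewrite ge_min lexx orbT.
    by move=> /le_lt_trans; apply; lra.
  - by rewrite mulr_ge0 ?powR_ge0.
  - move=> j /HJ[fl dG]; apply: le_trans (lojal _ (theta_bnd _) fl) _.
    rewrite -mulrA ler_wpM2l// -powRM//.
    have he : enorm (h (x j)) <= d%:R * G j := enorm_le_normr _.
    apply: le_trans (_ : enorm (h (x j)) `^ nu <= _).
      apply: powR_exponent_anti; first by rewrite sqrtr_ge0 (le_trans he).
        exact: lt_trans ltr01 nu1.
      by rewrite ge_min lexx.
    by rewrite ge0_ler_powR ?nnegrE ?sqrtr_ge0 ?mulr_ge0// ltW// (lt_trans ltr01).
pose D j := 2 * (T * G j + eps j).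
have xD j : `|x j.+1 - x j| <= D j.
  by apply: drift; have [/ltnW ->] := step j; rewrite leqnn.
have DS n : \sum_(0 <= j < n) D j <= 2 * (T * S + b * (r - 1)^-1).
  rewrite -mulr_sumr ler_pM2l// big_split/= -!mulr_sumr lerD//.
    by rewrite ler_pM2l.
  by rewrite ler_wpM2l// sum_powRN_le.
have xc := summable_increments_cvg xD DS.
have Dcvg : D j @[j --> \oo] --> 0.
  have epscvg : eps j @[j --> \oo] --> (b * 0 : R).
    apply: cvgM; first exact: cvg_cst.
    have r0 : 0 < r by lra.
    by have := powRN_natS_cvg0 r0; rewrite -cvg_shiftS.
  have -> : (0 : R) = 2 * (T * 0 + b * 0) by rewrite !mulr0 addr0 mulr0.
  apply: cvgM; first exact: cvg_cst.
  by apply: cvgD => //; apply: cvgM => //; exact: cvg_cst.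
(* each iterate late enough is close to the start of its block, which is
   close to the limit *)
exists (limn x).
  apply/cvgrPdist_lt => e e0.
  have e20 : 0 < e / 2 by rewrite divr_gt0.
  have [J _ HJ] : \forall j \near \oo, `|limn x - x j| < e / 2 /\ D j < e / 2.
    near=> j; split; near: j; first by move/cvgrPdist_lt : xc; exact.
    exact: cvgr_lt Dcvg _ e20.
  exists (nj J) => // n /= Jn.
  have Nn : (N <= n)%N by rewrite (leq_trans _ Jn)// block_time_ge.
  have [j /andP[jn nj1]] := block_time_cover alpha0 gamma_oo T0 alphaN Nn.
  have Jj : (J <= j)%N.
    rewrite leqNgt; apply/negP => jJ.
    have := block_time_mono alpha0 gamma_oo T0 alphaN jJ.
    by rewrite leqNgt (leq_ltn_trans Jn).
  have [xj Dj] := HJ j Jj.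
  have := drift j n; rewrite jn (ltnW nj1) => /(_ isT) nxj.
  rewrite -(subrKA (x j)) (le_lt_trans (ler_normD _ _))//.
  by rewrite [`|x j - _|]distrC; move: nxj; rewrite -/(D j); lra.
have hc : h (x j) @[j --> \oo] --> h (limn x).
  apply: continuous_cvg xc; exact: locally_lipschitz_continuous.
have h0 : h (x j) @[j --> \oo] --> (0 : 'rV[R]_d) by exact: norm_cvg0.
exact: cvg_unique hc h0.
Unshelve. all: by end_near. Qed.

Unset Implicit Arguments.

Theorem theorem2p1 (R : realType) (d : nat)
  (disp : measure_display) (Omega : measurableType disp)
  (P : probability Omega R)
  (f : 'rV[R]_d -> R) (alpha : nat -> R)
  (theta xi : nat -> Omega -> 'rV[R]_d)
  (f_diff : forall x : 'rV[R]_d, differentiable f x)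
  (f_lip : locally_lipschitz (gradient f))
  (alpha_gt0 : forall n, 0 < alpha n)
  (theta_rv : forall n, random_vector (theta n))
  (xi_rv : forall n, random_vector (xi n))
  (theta_rec : forall n w,
    theta n.+1 w = theta n w - alpha n *: (gradient f (theta n w) + xi n w))
  (A1 : alpha n @[n --> \oo] --> 0 /\
        (\sum_(0 <= i < n) alpha i) @[n --> \oo] --> +oo)
  (A2 : exists r : R, 1 < r /\
    {ae P, forall w, bounded_seq (theta ^~ w) ->
      forall t : R, 0 < t ->
        (limn_esup (fun n =>
           (max_weighted_sum alpha r (xi ^~ w) t n)%:E) < +oo)%E})
  (A3 : forall Q : set 'rV[R]_d, compact Q -> forall a : R, (f @` Q) a ->
    exists delta mu M : R,
      [/\ 0 < delta <= 1, 1 < mu <= 2, 1 <= M &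
        forall x, Q x -> `|f x - a| <= delta ->
          `|f x - a| <= M * enorm (gradient f x) `^ mu]) :
  {ae P, forall w, bounded_seq (theta ^~ w) ->
    exists2 theta_hat : 'rV[R]_d,
      theta n w @[n --> \oo] --> theta_hat & gradient f theta_hat = 0}.
Proof.
have [alpha_cvg0 gamma_oo] := A1; have [r [r1 noise]] := A2.
apply: filterS noise => w noise_w bnd_w.
have [rho theta_bnd] : exists rho, forall n, `|theta n w| <= rho.
  have [rho bnd] := ereal_sup_lt_pinfty bnd_w.
  by exists rho => n; apply: le_trans (normr_le_enorm _) (bnd n I).
apply: (@perturbed_gradient_cvg R d f alpha (theta ^~ w) (xi ^~ w) r rho) => //.
- by move=> t t0; apply: limn_esup_lt_pinfty; exact: noise_w.
- move=> a fa; have [delta [mu [M [/andP[delta0 _] /andP[mu1 _] M1 ineq]]]] :=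
    A3 _ (@compact_norm_ball R d rho) a fa.
  by exists delta, mu, M; split => //; exact: le_trans ler01 M1.
Qed.
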